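(* Let $\varepsilon>0$, $\theta_\varepsilon=\varepsilon/(1+\varepsilon)$, and let $\mathcal{T}=(a,b,c)$ be a parity-class triple with $K=(a+b)/2>1$ and $E_\varepsilon(\mathcal{T})\ge0$. Put $s=\min\{a,b\}$. Then $$d_ad_b\ \le\ \frac{2K-s}{R_{\mathcal K}(\mathcal{T})\,(2K)^{\theta_\varepsilon}} .$$ Furthermore $$|\Gamma_{\mathcal{T}}|=d_ad_bK(K-s),$$ and therefore both $|\Gamma_{\mathcal{T}}|$ and the squarefree twist parameter $\gamma_{\mathcal{T}}$ are at most $$\frac{K(K-s)(2K-s)}{R_{\mathcal K}(\mathcal{T})\,(2K)^{\theta_\varepsilon}} .$$
   Context: A parity-class triple is a triple $\mathcal{T}=(a,b,c)$ of pairwise coprime positive integers with $a+b=c$, $a$ and $b$ odd, $c$ even. Put $K=(a+b)/2$ and $M=(b-a)/2$, so $c=2K$. $\mathrm{rad}(n)$ is the product of the distinct primes dividing $n$, and $E_\varepsilon(\mathcal{T})=\log c-(1+\varepsilon)\log\mathrm{rad}(abc)$. Put $R_{\mathcal K}(\mathcal{T})=\prod_{p\mid K,\ p\text{ odd prime}}p$. Write $a=d_au_a^2$ and $b=d_bu_b^2$ with $d_a,d_b$ positive squarefree integers and $u_a,u_b$ positive integers. Put $\Gamma_{\mathcal{T}}=d_ad_bKM$ (nonzero when $K>1$), and let $\gamma_{\mathcal{T}}$ be the squarefree part of $|\Gamma_{\mathcal{T}}|$, i.e. $|\Gamma_{\mathcal{T}}|$ divided by its largest square divisor. *)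

(* Defs.v *)
From mathcomp Require Import all_boot all_order all_algebra.
From mathcomp Require Import reals exp.
Set Implicit Arguments.
Unset Strict Implicit.
Unset Printing Implicit Defensive.
Import Order.TTheory GRing.Theory Num.Theory.

Local Open Scope nat_scope.

Definition rad (n : nat) : nat := \prod_(p <- primes n) p.

Definition squarefree (n : nat) : Prop :=
  0 < n /\ forall d : nat, d ^ 2 %| n -> d = 1.

(* For n > 0, every d with d ^ 2 %| n satisfies d <= n, so the maximum runs
   over all square divisors of n. *)
Definition largest_square_divisor (n : nat) : nat :=
  \max_(d < n.+1 | d ^ 2 %| n) d ^ 2.

Definition squarefree_part (n : nat) : nat := n %/ largest_square_divisor n.

Record parity_triple := ParityTriple {
  ta : nat;
  tb : nat;
  tc : nat;
  ta_gt0 : 0 < ta;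
  tb_gt0 : 0 < tb;
  tc_gt0 : 0 < tc;
  coprime_ab : coprime ta tb;
  coprime_ac : coprime ta tc;
  coprime_bc : coprime tb tc;
  t_sum : ta + tb = tc;
  odd_ta : odd ta;
  odd_tb : odd tb;
  even_tc : ~~ odd tc }.

(* a + b and b - a are even, so the two integer divisions by 2 are exact;
   M is signed, since a < b is not assumed. *)
Definition tK (T : parity_triple) : nat := (ta T + tb T) %/ 2.

Definition tM (T : parity_triple) : int := (((tb T)%:Z - (ta T)%:Z)%R %/ 2)%Z.

Definition radK (T : parity_triple) : nat := \prod_(p <- primes (tK T) | odd p) p.

Local Open Scope ring_scope.

Definition Gamma (T : parity_triple) (da db : nat) : int :=
  da%:Z * db%:Z * (tK T)%:Z * tM T.

Definition gamma (T : parity_triple) (da db : nat) : nat :=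
  squarefree_part `|Gamma T da db|%N.

Definition excess (R : realType) (eps : R) (T : parity_triple) : R :=
  ln (tc T)%:R - (1 + eps) * ln (rad (ta T * tb T * tc T)%N)%:R.

Definition theta (R : realType) (eps : R) : R := eps / (1 + eps).

(* Main.v *)
Require Import Defs.
From mathcomp Require Import all_boot all_order all_algebra.
From mathcomp Require Import reals exp.
From mathcomp Require Import zify ring lra.
Set Implicit Arguments.
Unset Strict Implicit.
Unset Printing Implicit Defensive.
Import Order.TTheory GRing.Theory Num.Theory.
Local Open Scope ring_scope.

(** The theorem is the radical inequality read backwards.  Since the squarefree
    part of an integer divides its radical, [da * db <= rad a * rad b].  As [a],
    [b], [c = 2K] are pairwise coprime and [c] is even,
    [rad (a * b * c) = rad a * rad b * 2 * radK].  The hypothesis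
    [0 <= excess eps T] says [rad (a * b * c) <= c `^ (1 / (1 + eps))], that is,
    [rad (a * b * c) * c `^ theta eps <= c], because
    [1 / (1 + eps) = 1 - theta eps].  Dividing by [2] gives
    [da * db * (radK * (2K) `^ theta eps) <= K], and [K <= 2K - s] since [2K - s]
    is the larger of [a] and [b], whose mean is [K].

    The formula for [Gamma] is [|M| = K - s], the distance from the mean [K] of
    [a] and [b] to either of them.  The two remaining bounds follow on
    multiplying by [K * (K - s) >= 0]; the squarefree part of an integer is a
    quotient of it, hence no larger. *)

(* The name [rad] alone denotes the radical of a sesquilinear form here. *)
Local Notation rad := Defs.rad.

Lemma prime_primes n : {in primes n, forall p, prime p}.
Proof. by move=> p; rewrite mem_primes => /and3P[]. Qed.

Lemma rad_gt0 n : (0 < rad n)%N.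
Proof.
by rewrite /rad big_seq; apply: prodn_cond_gt0 => p /prime_primes/prime_gt0.
Qed.

Lemma radM m n : (0 < m)%N -> (0 < n)%N -> coprime m n ->
  rad (m * n)%N = (rad m * rad n)%N.
Proof.
move=> m_gt0 n_gt0 co_mn; rewrite /rad -big_cat; apply: perm_big.
apply: uniq_perm => [||p].
- exact: primes_uniq.
- by rewrite cat_uniq !primes_uniq andbT /= -coprime_has_primes.
- by rewrite mem_cat primesM.
Qed.

Lemma rad_leq_dvd m n : (0 < n)%N -> (m %| n)%N -> (rad m <= rad n)%N.
Proof.
move=> n_gt0 m_dvd_n.
have n_mem p : p \in primes m -> p \in primes n.
  rewrite !mem_primes => /and3P[-> _ /dvdn_trans/(_ m_dvd_n) ->].
  by rewrite n_gt0.
rewrite {2}/rad (bigID [in primes m]) /=.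
have -> : (\prod_(p <- primes n | p \in primes m) p)%N = rad m.
  rewrite -big_filter; apply: perm_big; apply: uniq_perm.
  - exact/filter_uniq/primes_uniq.
  - exact: primes_uniq.
  - by move=> p; rewrite mem_filter; apply/andP/idP => [[]|/[dup] /n_mem].
rewrite leq_pmulr // big_seq_cond; apply: prodn_cond_gt0 => p /andP[].
by move=> /prime_primes/prime_gt0.
Qed.

(** Each prime occurs in a squarefree [n] with exponent exactly one, so the
    prime factorization of [n] is the product that defines [rad n]. *)
Lemma rad_squarefree n : squarefree n -> rad n = n.
Proof.
move=> [n_gt0 sqf]; rewrite [RHS]prod_prime_decomp // prime_decompE big_map.
rewrite /rad !big_seq; apply: eq_bigr => p p_n /=.
have p_pr := prime_primes p_n.
have: (0 < logn p n)%N by rewrite logn_gt0.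
have : ~~ (1 < logn p n)%N.
  apply/negP; rewrite -pfactor_dvdn // => /sqf p1.
  by rewrite p1 in p_pr.
by case: (logn p n) => [|[|k]].
Qed.

(** The product counts the prime [2] once, whatever the parity of [n]: this
    isolates the factor [2] that makes [radK] smaller than [rad c]. *)
Lemma rad_double n : (0 < n)%N ->
  rad (2 * n)%N = (2 * \prod_(p <- primes n | odd p) p)%N.
Proof.
move=> n_gt0; have mem2n p : (p \in primes (2 * n)) = (p == 2) || (p \in primes n).
  by rewrite primesM // mem_seq1.
rewrite /rad (bigD1_seq 2%N) ?primes_uniq ?mem2n //=; congr (_ * _)%N.
rewrite -[LHS]big_filter -[RHS]big_filter; apply: perm_big; apply: uniq_perm.
- exact/filter_uniq/primes_uniq.
- exact/filter_uniq/primes_uniq.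
move=> p; rewrite !mem_filter mem2n.
have [->|p_neq2] := eqVneq p 2%N; first by [].
case: (boolP (p \in primes n)) => [/prime_primes p_pr|]; rewrite ?andbF //=.
by case: (even_prime p_pr) => [p2|->//]; rewrite p2 in p_neq2.
Qed.

Lemma squarefree_part_leq n : (squarefree_part n <= n)%N.
Proof. exact: leq_div. Qed.

Lemma double_tK T : (2 * tK T)%N = tc T.
Proof. by rewrite /tK mulnC divnK ?t_sum // dvdn2 even_tc. Qed.

Lemma normr_tM T :
  `|tM T| = (tK T)%:Z - (minn (ta T) (tb T))%:Z.
Proof.
have := double_tK T; have := t_sum T; have := odd_ta T; have := odd_tb T.
rewrite /tM; lia.
Qed.

Lemma rad_triple T :
  rad (ta T * tb T * tc T)%N = (rad (ta T) * rad (tb T) * (2 * radK T))%N.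
Proof.
have a_gt0 := ta_gt0 T; have b_gt0 := tb_gt0 T; have c_gt0 := tc_gt0 T.
rewrite radM ?muln_gt0 ?a_gt0 // ?coprimeMl ?coprime_ac ?coprime_bc //.
rewrite radM ?coprime_ab // -(double_tK T) rad_double //.
by move: c_gt0; rewrite -double_tK; case: tK.
Qed.

(** The bound [ln r <= ln c / (1 + eps)] on a radical [r] is the logarithm of
    this one, because [1 / (1 + eps) = 1 - theta eps]. *)
Lemma rad_powR_theta_le (R : realType) (eps : R) T : 0 < eps ->
  0 <= excess eps T ->
  (rad (ta T * tb T * tc T)%N)%:R * (tc T)%:R `^ theta eps <= (tc T)%:R.
Proof.
move=> eps_gt0; rewrite /excess.
set r : R := (rad _)%:R; set c : R := (tc T)%:R => exc.
have r_gt0 : 0 < r by rewrite ltr0n rad_gt0.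
have c_gt0 : 0 < c by rewrite ltr0n tc_gt0.
have ct_gt0 : 0 < c `^ theta eps by rewrite powR_gt0.
rewrite -ler_ln ?posrE ?mulr_gt0 // lnM ?posrE // ln_powR.
rewrite -(ler_pM2l (_ : 0 < 1 + eps)); last lra.
have -> : (1 + eps) * (ln r + theta eps * ln c) = (1 + eps) * ln r + eps * ln c.
  by rewrite /theta; field; lra.
lra.
Qed.

Theorem theorem8p17 (R : realType) (eps : R) (T : parity_triple)
    (da ua db ub : nat) :
  0 < eps ->
  squarefree da -> (0 < ua)%N -> ta T = (da * ua ^ 2)%N ->
  squarefree db -> (0 < ub)%N -> tb T = (db * ub ^ 2)%N ->
  (1 < tK T)%N ->
  0 <= excess eps T ->
  let K := tK T in
  let s := minn (ta T) (tb T) in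
  let D : R := (radK T)%:R * (2 * K%:R) `^ theta eps in
  let B : R := K%:R * (K%:R - s%:R) * (2 * K%:R - s%:R) / D in
  [/\ da%:R * db%:R <= (2 * K%:R - s%:R) / D,
      `|Gamma T da db| = da%:Z * db%:Z * K%:Z * (K%:Z - s%:Z),
      `|Gamma T da db|%:~R <= B &
      (gamma T da db)%:R <= B].
Proof.
move=> eps_gt0 sqf_da ua_gt0 def_a sqf_db ub_gt0 def_b K_gt1 exc K s D B.
have s_le_K : (s <= K)%N.
  by have := double_tK T; have := t_sum T; rewrite /s /K; lia.
have s_le_KR : s%:R <= K%:R :> R by rewrite ler_nat.
have cE : 2 * K%:R = (tc T)%:R :> R by rewrite -natrM double_tK.
have D_gt0 : 0 < D.
  rewrite mulr_gt0 ?powR_gt0 ?cE ?ltr0n ?tc_gt0 //.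
  by have := rad_gt0 (ta T * tb T * tc T)%N; rewrite rad_triple !muln_gt0 => /and3P[].
have dadb_rad : da%:R * db%:R <= (rad (ta T) * rad (tb T))%:R :> R.
  rewrite -natrM ler_nat leq_mul // -[leqLHS]rad_squarefree //;
    by rewrite rad_leq_dvd ?ta_gt0 ?tb_gt0 // ?def_a ?def_b dvdn_mulr.
have dadb_le : da%:R * db%:R <= (2 * K%:R - s%:R) / D.
  rewrite ler_pdivlMr //.
  (* [K] is the mean of [a] and [b], and [2K - s] the larger of the two. *)
  apply: (@le_trans _ _ K%:R); last lra.
  apply: le_trans (ler_wpM2r (ltW D_gt0) dadb_rad) _.
  have := rad_powR_theta_le eps_gt0 exc; rewrite rad_triple -cE /D.
  rewrite !natrM; lra.
have GammaE : `|Gamma T da db| = da%:Z * db%:Z * K%:Z * (K%:Z - s%:Z).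
  by rewrite /Gamma !normrM normr_tM.
have Gamma_le : `|Gamma T da db|%:~R <= B.
  rewrite GammaE !intrM intrB -!pmulrn /B -!mulrA.
  have KKs_ge0 : 0 <= K%:R * (K%:R - s%:R) :> R by rewrite mulr_ge0 ?subr_ge0.
  have := ler_wpM2l KKs_ge0 dadb_le.
  lra.
split=> //; apply: le_trans Gamma_le.
by rewrite -abszE -pmulrn ler_nat squarefree_part_leq.
Qed.
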